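(* Let $m\in\mathbb{N}$ and let $g$ be a real-valued continuous function on $[0,\infty)$ such that the limit $\lim_{t\to\infty}g(t)=g(\infty)$ exists and $g(\infty)\ge 0$. If $\kappa^-(g,Y)\ge 1$ for some finite set $Y\subset\mathbb{R}^m$, then $\kappa_m^-(g)=+\infty$. In particular, $\kappa_{n+1}^-(g)=+\infty$ for each $g\in\Phi_n\setminus\Phi_{n+1}$ with $n\ge 2$.
   Context: For $n\in\mathbb{N}$, $|\cdot|_n$ is the Euclidean norm on $\mathbb{R}^n$. $\Phi_n$ is the class of radial positive definite functions on $\mathbb{R}^n$: real-valued continuous functions $f$ on $[0,\infty)$ such that for every finite set $\{x_1,\dots,x_m\}\subset\mathbb{R}^n$ and all $\xi_1,\dots,\xi_m\in\mathbb{C}$ one has $\sum_{k,j=1}^m f(|x_k-x_j|_n)\,\xi_j\overline{\xi_k}\ge 0$. For a real-valued continuous function $g$ on $[0,\infty)$ and a finite set $X=\{x_j\}_{j=1}^N\subset\mathbb{R}^n$ of distinct points, $\kappa^-(g,X)$ denotes the number of negative eigenvalues, counting multiplicity, of the Schoenberg matrix $\|g(|x_i-x_j|_n)\|_{i,j=1}^N$, and $$\kappa_n^-(g)=\sup\{\kappa^-(g,X): X \text{ a finite subset of } \mathbb{R}^n\}.$$ *)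

(* Defs.v *)
From HB Require Import structures.
From mathcomp Require Import all_boot all_order all_algebra.
From mathcomp Require Import all_classical all_reals all_analysis.
From mathcomp Require Import complex polyrcf.
Import Order.TTheory GRing.Theory Num.Theory.
Import numFieldNormedType.Exports.

Set Implicit Arguments.
Unset Strict Implicit.
Unset Printing Implicit Defensive.

Local Open Scope classical_set_scope.
Local Open Scope ring_scope.
Local Open Scope complex_scope.

(* The norm that MathComp-Analysis puts on ['rV[R]_n] is the sup norm. *)
Definition enorm (R : realType) (n : nat) (x : 'rV[R]_n) : R :=
  Num.sqrt (\sum_(i < n) x ord0 i ^+ 2).

(* A real function on [0, +oo) is represented by a total [g : R -> R] whose
   values at negative arguments are never used. *)
Definition continuous_nneg (R : realType) (g : R -> R) : Prop :=
  {within `[0, +oo[%classic, continuous g}.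

(* A finite set of N points is represented by an injective enumeration
   ['I_N -> 'rV[R]_n]. The last conjunct is an inequality in [R[i]]: [0 <= z]
   means that z is real and nonnegative. *)
Definition Phi (R : realType) (n : nat) (f : R -> R) : Prop :=
  continuous_nneg f /\
  forall (N : nat) (x : 'I_N -> 'rV[R]_n) (xi : 'I_N -> R[i]),
    injective x ->
    0 <= \sum_(k < N) \sum_(j < N)
           (f (enorm (x k - x j)))%:C * xi j * (xi k)^*.

Definition schoenberg_mx (R : realType) (g : R -> R) (n N : nat)
    (x : 'I_N -> 'rV[R]_n) : 'M[R]_N :=
  \matrix_(i < N, j < N) g (enorm (x i - x j)).

(* [rootsR p] lists each real root of [p] once; the multiplicity of an
   eigenvalue is its multiplicity as a root of the characteristic polynomial. *)
Definition nb_neg_eigenvalues (R : realType) (N : nat) (A : 'M[R]_N) : nat :=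
  (\sum_(a <- rootsR (char_poly A) | (a < 0)%R) mup a (char_poly A))%N.

Definition kappa_minus (R : realType) (g : R -> R) (n N : nat)
    (x : 'I_N -> 'rV[R]_n) : nat :=
  nb_neg_eigenvalues (schoenberg_mx g x).

Definition kappa_minus_sup (R : realType) (n : nat) (g : R -> R) : \bar R :=
  ereal_sup [set k : \bar R | exists (N : nat) (x : 'I_N -> 'rV[R]_n),
    injective x /\ k = ((kappa_minus g x)%:R)%:E].

(* Main.v *)
Require Import Defs.
From HB Require Import structures.
From mathcomp Require Import all_boot all_order all_algebra.
From mathcomp Require Import all_classical all_reals all_analysis.
From mathcomp Require Import complex polyrcf spectral freeg.
From mathcomp Require Import ring lra zify.
Import Order.TTheory GRing.Theory Num.Theory.
Import numFieldNormedType.Exports.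
Set Implicit Arguments.
Unset Strict Implicit.
Unset Printing Implicit Defensive.

Local Open Scope classical_set_scope.
Local Open Scope ring_scope.

(** First part. Let [v] be a vector on which the Schoenberg form of [Y] has a
    value [q < 0], and translate [Y] along a line to obtain copies that are very far
    from each other. Two different copies interact through very large
    distances, so the form pairs [v] on one copy with [v] on another by about
    [ginfty * s ^+ 2], where [s] is the sum of the entries of [v]. On
    combinations of the copies whose coefficients add up to zero a constant
    interaction drops out, and what remains on the diagonal is
    [q - ginfty * s ^+ 2 <= q < 0]. Hence [d + 1] copies give a negative
    definite space of dimension [d] ([kappa_minus_unbounded]), and such a space
    forces [d] negative eigenvalues ([neg_def_le_nb_neg_eigenvalues]).

    Second part. A function of [Phi n] outside [Phi n.+1] has a Schoenberg matrix in
    dimension [n + 1] with a negative eigenvalue ([not_Phi_kappa_minus]), so it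
    remains to see that every [f] in [Phi n] with [2 <= n] has a nonnegative
    limit at infinity ([Phi_cvg_pinfty]). Schoenberg's integral representation
    would give this at once; the following argument needs no integral.

    Only the plane matters. Let [c >= 0] be the infimum of the energy
    [\sum_(x, y) mu x * mu y * f |x - y|] over finitely supported signed
    measures of mass one. The kernel [h |x - y|] with [h = f - c] is still
    positive semidefinite; it is a Gram matrix of vectors [U_x k], the translates
    of one vector [k], in which some combinations [\sum_x mu x * U_x k] of mass
    one are arbitrarily short. Averages over long arithmetic progressions, in
    the style of the mean ergodic theorem, then have two properties.
    - Let [A_i] average along the line of direction [d_i]. For two independent
      directions, averaging along both is almost invariant under all the
      translations that occur in a short combination [mu] of mass one, so it
      maps [k] to about the image of the short combination, a short vector;
      by duality the vectors [U_x (A_i k)] and [U_y (A_j k)] are almost orthogonal,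
      uniformly in [x] and [y] ([form_avg_small]).
    - If [n_i] is a unit normal to [d_i] and [t] is large, moving the point
      [t n_i] by a bounded amount along [d_i] hardly changes its distance to the
      origin, so [h t] is about the inner product of [k] with
      [U_(t n_i) (A_i k)] ([form_avg_orth]).

    With [m] directions, [h t] is therefore about the inner product of [k] with
    the mean of [m] almost orthogonal vectors of bounded length, which is
    [O(m ^ (- 1 / 2))]: [h] tends to zero and [f] to [c]
    ([radial_vanishes_at_infinity]). *)

(** * Negative eigenvalues and negative definite spaces *)

Local Notation adjmx M := (map_mx Num.conj M^T).

Lemma nb_neg_eigenvalues_prod (R : realType) (N : nat) (A : 'M[R]_N)
    (d : 'I_N -> R) :
  char_poly A = \prod_(i < N) ('X - (d i)%:P) ->
  nb_neg_eigenvalues A = #|[pred i | d i < 0]|.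
Proof.
move=> pA.
have pA0 : char_poly A != 0 by rewrite monic_neq0 ?char_poly_monic.
have mupE a : mup a (char_poly A) = (\sum_(i < N) (d i == a))%N.
  have -> : char_poly A = \prod_(y <- [seq d i | i <- enum 'I_N]) ('X - y%:P).
    by rewrite pA big_map big_enum.
  by rewrite mu_prod_XsubC count_map -sum1_count big_mkcond /= big_enum.
rewrite /nb_neg_eigenvalues (eq_bigr _ (fun a _ => mupE a)) exchange_big /=.
rewrite -sum1_card [RHS]big_mkcond /=; apply: eq_bigr => i _.
have rdi : d i \in rootsR (char_poly A).
  have -> : (d i \in rootsR (char_poly A)) =
      (d i \in `]-oo, +oo[ ) && root (char_poly A) (d i).
    by rewrite -(roots_on_rootsR pA0).
  rewrite in_itv /= pA /root horner_prod.
  by apply/prodf_eq0; exists i => //; rewrite !hornerE subrr.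
rewrite big_mkcond (bigD1_seq (d i)) ?uniq_roots //= eqxx big1 ?addn0.
  by rewrite inE.
by move=> a /negPf; rewrite eq_sym => ->; case: ifP.
Qed.

Lemma char_poly_similar (F : comUnitRingType) (n : nat) (P D : 'M[F]_n) :
  P \in unitmx -> char_poly (invmx P *m D *m P) = char_poly D.
Proof.
move=> uP; rewrite /char_poly /char_poly_mx !map_mxM /=.
set p := map_mx _ P; set q := map_mx _ (invmx P).
have qp : q *m p = 1%:M by rewrite -map_mxM mulVmx // map_mx1.
have XE : 'X%:M = q *m ('X%:M) *m p by rewrite scalar_mxC -mulmxA qp mulmx1.
rewrite {1}XE.
by rewrite -mulmxBl -mulmxBr !det_mulmx mulrAC -det_mulmx qp det1 mul1r.
Qed.

Lemma adjmxM (C : numClosedFieldType) m n p (A : 'M[C]_(m, n))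
    (B : 'M[C]_(n, p)) : adjmx (A *m B) = adjmx B *m adjmx A.
Proof. by rewrite trmx_mul map_mxM. Qed.

Lemma adjmxK (C : numClosedFieldType) m n (A : 'M[C]_(m, n)) :
  adjmx (adjmx A) = A.
Proof. by apply/matrixP => i j; rewrite !mxE conjCK. Qed.

Lemma sym_form (F : comNzRingType) (N : nat) (A : 'M[F]_N) (x y : 'rV[F]_N) :
  A^T = A -> x *m A *m y^T = y *m A *m x^T.
Proof.
move=> symA; have -> : x *m A *m y^T = (x *m A *m y^T)^T.
  by apply/matrixP => i j; rewrite !ord1 [RHS]mxE.
by rewrite !trmx_mul trmxK symA mulmxA.
Qed.

(** If there were fewer than [d] negative eigenvalues, a nonzero vector of the
    space would be orthogonal to all their eigenvectors, and the form is
    nonnegative on such a vector. The eigenvectors come from the spectral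
    theorem over [R[i]]; a complex combination of the rows of [C] splits into
    its real and imaginary parts, each of which contributes a nonpositive
    amount to the form, one of them a negative one. *)
Lemma neg_def_le_nb_neg_eigenvalues (R : realType) (N d : nat) (A : 'M[R]_N)
    (C : 'M[R]_(d, N)) :
  A^T = A ->
  (forall a : 'rV[R]_d, a != 0 -> (a *m C *m A *m (a *m C)^T) 0 0 < 0) ->
  (d <= nb_neg_eigenvalues A)%N.
Proof.
move=> symA negC.
pose f := real_complex R.
pose AC := map_mx f A.
have hermA : AC \is hermsymmx.
  apply/is_hermitianmxP; rewrite expr0 scale1r; apply/matrixP => i j; rewrite !mxE.
  by rewrite -[in LHS]symA mxE; apply/esym/conjc_real.
have realsp := hermitian_spectral_diag_real hermA.
have /hermitian_normalmx/orthomx_spectralP := hermA.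
set P := spectralmx AC; set sp := spectral_diag AC => ACE.
have uP : P \is unitarymx by exact: spectral_unitarymx.
have unP : P \in unitmx by exact: unitarymx_unit.
pose e i := complex.Re (sp 0 i).
have spE i : sp 0 i = f (e i).
  by rewrite /e /f RRe_real //; have /mxOverP := realsp; apply.
have pA : char_poly A = \prod_(i < N) ('X - (e i)%:P).
  apply: (map_inj_poly (@complexI R) (rmorph0 _)).
  rewrite map_char_poly -/AC ACE char_poly_similar //.
  rewrite char_poly_trig ?diag_mx_is_trig // rmorph_prod /=.
  apply: eq_bigr => i _.
  by rewrite mxE eqxx mulr1n rmorphB /= map_polyX map_polyC /= spE.
rewrite (nb_neg_eigenvalues_prod pA) leqNgt; apply/negP => lt_d.
pose CP := map_mx f C *m adjmx P.
(* [E] keeps the coordinates in the eigenvectors with negative eigenvalue. *)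
pose E := colsub (fun l : 'I_#|[pred i | e i < 0]| => enum_val l) CP.
have : kermx E != 0.
  rewrite -mxrank_eq0 mxrank_ker subn_eq0 -ltnNge.
  exact: leq_ltn_trans (rank_leq_col _) lt_d.
move=> /rowV0Pn [a /sub_kermxP aE a0].
pose w := a *m CP.
have w0 i : e i < 0 -> w 0 i = 0.
  move=> ei; have ie : i \in [pred i | e i < 0] by rewrite inE.
  have := congr1 (fun M : 'rV_ _ => M 0 (enum_rank_in ie i)) aE.
  rewrite mxE [RHS]mxE => <-; rewrite /w mxE; apply: eq_bigr => j _.
  by rewrite [E _ _]mxE enum_rankK_in.
have form_ge0 : 0 <= (a *m map_mx f C *m AC *m adjmx (a *m map_mx f C)) 0 0.
  have -> : a *m map_mx f C *m AC *m adjmx (a *m map_mx f C)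
      = w *m diag_mx sp *m adjmx w.
    have -> : w = a *m map_mx f C *m adjmx P by rewrite /w /CP mulmxA.
    rewrite [adjmx (_ *m adjmx P)]adjmxM adjmxK -(invmx_unitary uP) {1}ACE.
    by rewrite !mulmxA.
  rewrite mul_mx_diag mxE sumr_ge0 // => i _.
  rewrite mxE [map_mx _ _ _ _]mxE [w^T _ _]mxE mulrAC spE.
  have [ei|ei] := ltP (e i) 0; first by rewrite w0 // !mul0r.
  by rewrite mulr_ge0 ?mul_conjC_ge0 // /f ler0c.
pose x := map_mx (@complex.Re R) a; pose y := map_mx (@complex.Im R) a.
have aE' : a = map_mx f x + 'i%C *: map_mx f y.
  by apply/rowP => j; rewrite !mxE [LHS]complexE.
have formE : (a *m map_mx f C *m AC *m adjmx (a *m map_mx f C)) 0 0 =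
   f ((x *m C *m A *m (x *m C)^T) 0 0 + (y *m C *m A *m (y *m C)^T) 0 0).
  pose X := x *m C; pose Y := y *m C.
  have -> : a *m map_mx f C = map_mx f X + 'i%C *: map_mx f Y.
    by rewrite aE' mulmxDl -scalemxAl -!map_mxM.
  have conjf M : map_mx Num.conj (map_mx f M : 'cV_N) = map_mx f M.
    by apply/matrixP => i j; rewrite !mxE; apply: conjc_real.
  have -> : adjmx (map_mx f X + 'i%C *: map_mx f Y) =
      map_mx f X^T - 'i%C *: map_mx f Y^T.
    rewrite linearD linearZ /= map_mxD map_mxZ !map_trmx !conjf.
    by congr (_ + _); rewrite -scaleNr; congr (_ *: _); apply/eqP;
       rewrite eq_complex /= oppr0 !eqxx.
  have XY := sym_form X Y symA.
  rewrite mulmxBr !mulmxDl -!scalemxAr -!scalemxAl -!map_mxM XY.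
  rewrite scalerA -expr2 sqr_i scaleN1r opprD opprK addrA addrK.
  by rewrite mxE [X in X + _]mxE [X in _ + X]mxE /f rmorphD.
move: form_ge0; rewrite formE ler0c leNgt => /negP; apply.
have neg (z : 'rV_d) : (z *m C *m A *m (z *m C)^T) 0 0 <= 0.
  have [->|z0] := eqVneq z 0; last exact/ltW/negC.
  by rewrite !mul0mx mxE.
have [x0|x0] := eqVneq x 0.
  have y0 : y != 0.
    apply: contraNneq a0 => y0.
    by rewrite aE' x0 y0 !map_mx0 scaler0 addr0.
  by rewrite -[ltRHS]addr0 ler_ltD ?negC.
by rewrite -[ltRHS]addr0 ltr_leD ?negC.
Qed.

Lemma nb_neg_eigenvalues_gt0 (R : realType) (N : nat) (A : 'M[R]_N) :
  (0 < nb_neg_eigenvalues A)%N ->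
  exists v : 'rV[R]_N, (v *m A *m v^T) 0 0 < 0.
Proof.
rewrite /nb_neg_eigenvalues => k1.
have pA0 : char_poly A != 0 by rewrite monic_neq0 ?char_poly_monic.
have /hasP[a _ /andP[a0 ma]] :
    has (fun a => (a < 0) && (0 < mup a (char_poly A))%N)
        (rootsR (char_poly A)).
  move: k1; apply: contraTT => /hasPn H; rewrite -leqNgt leqn0.
  rewrite big_seq_cond big1 // => a /andP[/H]; rewrite negb_and => + a0.
  by rewrite a0 /= -eqn0Ngt => /eqP.
have : root (char_poly A) a by rewrite -dvdp_XsubCl XsubC_dvd.
rewrite -eigenvalue_root_char => /eigenvalueP [v vA v0].
exists v; rewrite vA -scalemxAl mxE pmulr_llt0 //.
rewrite mxE lt0r; apply/andP; split; last first.
  by apply: sumr_ge0 => i _; rewrite mxE -expr2 sqr_ge0.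
rewrite psumr_eq0; last by move=> i _; rewrite mxE -expr2 sqr_ge0.
have /rV0Pn [i vi] := v0.
apply/allPn; exists i; first by rewrite mem_index_enum.
by rewrite mxE mulf_neq0.
Qed.

(** * Distant copies of a configuration *)

Lemma mx_formE (F : comNzRingType) (N : nat) (A : 'M[F]_N) (v : 'rV[F]_N) :
  (v *m A *m v^T) 0 0 = \sum_p \sum_q v 0 p * v 0 q * A p q.
Proof.
rewrite mxE exchange_big /=; apply: eq_bigr => q _; rewrite !mxE mulr_suml.
by apply: eq_bigr => p _; rewrite mulrAC.
Qed.

Lemma enormN (R : realType) n (x : 'rV[R]_n) : enorm (- x) = enorm x.
Proof.
by congr Num.sqrt; apply: eq_bigr => i _; rewrite mxE sqrrN.
Qed.

Lemma ler_coord_enorm (R : realType) n (x : 'rV[R]_n) i : `|x 0 i| <= enorm x.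
Proof.
rewrite -sqrtr_sqr /enorm ler_wsqrtr // (bigD1 i) //= lerDl sumr_ge0 // => j _.
exact: sqr_ge0.
Qed.

Lemma schoenberg_mx_sym (R : realType) (g : R -> R) n N (x : 'I_N -> 'rV[R]_n) :
  (schoenberg_mx g x)^T = schoenberg_mx g x.
Proof. by apply/matrixP => i j; rewrite !mxE -enormN opprB. Qed.

(** Coefficients of sum zero do not see a constant subtracted from all the
    entries. Subtracting [kappa] leaves a diagonal [q - kappa <= q < 0] and
    entries of size [delta] off it; by [2 c_i c_j <= c_i ^ 2 + c_j ^ 2] these
    contribute at most [K * delta] times the sum of the squares. *)
Lemma zero_sum_form_lt0 (R : realFieldType) (K : nat) (G : 'I_K -> 'I_K -> R)
    (c : 'I_K -> R) (q kappa delta : R) :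
  0 <= kappa -> delta *+ K < - q ->
  (forall i, G i i = q) ->
  (forall i j, i != j -> `|G i j - kappa| <= delta) ->
  \sum_i c i = 0 -> (exists i, c i != 0) ->
  \sum_i \sum_j c i * c j * G i j < 0.
Proof.
move=> kappa0 small Gd Go c0 [i0 ci0].
set S := \sum_i c i ^+ 2.
have S0 : 0 < S.
  by rewrite /S (bigD1 i0) //= ltr_pwDl ?sumr_ge0 ?exprn_even_gt0 // => i _;
     exact: sqr_ge0.
have delta0 : 0 <= delta -> forall i j,
    c i * c j * (G i j - kappa) <=
      (if i == j then q * c i ^+ 2 else 0)
      + delta * ((c i ^+ 2 + c j ^+ 2) / 2).
  move=> delta0 i j.
  have sq : 0 <= (c i ^+ 2 + c j ^+ 2) / 2.
    by rewrite divr_ge0 // addr_ge0 ?sqr_ge0.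
  case: (eqVneq i j) sq => [<-|ij] sq.
    rewrite Gd -expr2 -[leLHS]addr0 lerD //; last exact: mulr_ge0.
    by rewrite mulrC ler_wpM2r ?sqr_ge0 // gerBl.
  rewrite add0r (le_trans (ler_norm _)) // !normrM mulrC ler_pM ?Go //.
  rewrite -(real_normK (num_real (c i))) -(real_normK (num_real (c j))).
  have := sqr_ge0 (`|c i| - `|c j|); nra.
(* A negative [delta] leaves a single index, whose coefficient is zero. *)
have [d0|d0] := leP 0 delta; last first.
  have K1 : forall i j : 'I_K, i = j.
    move=> i j; apply/eqP/negP => /negP /Go.
    by rewrite leNgt => /negP; apply; apply: lt_le_trans (normr_ge0 _).
  have := c0; rewrite (bigD1 i0) //= big_pred0 => [|j]; last first.
    by rewrite (K1 j i0) eqxx.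
  by rewrite addr0 => /eqP; rewrite (negPf ci0).
have -> : \sum_i \sum_j c i * c j * G i j =
    \sum_i \sum_j c i * c j * (G i j - kappa).
  have z : \sum_i \sum_j c i * c j * kappa = 0.
    by rewrite big1 // => i _; rewrite -mulr_suml -mulr_sumr c0 mulr0 mul0r.
  rewrite -[LHS]subr0 -[X in _ - X = _]z -sumrB; apply: eq_bigr => i _.
  by rewrite -sumrB; apply: eq_bigr => j _; rewrite mulrBr.
have le : \sum_i \sum_j c i * c j * (G i j - kappa) <=
    q * S + delta * (S *+ K).
  apply: (@le_trans _ _ (\sum_i \sum_j ((if i == j then q * c i ^+ 2 else 0)
      + delta * ((c i ^+ 2 + c j ^+ 2) / 2)))).
    by apply: ler_sum => i _; apply: ler_sum => j _; apply: delta0.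
  under eq_bigr do rewrite big_split /=.
  rewrite big_split /= lerD //.
    rewrite /S mulr_sumr ler_sum // => i _.
    by rewrite -big_mkcond /= (big_pred1 i) // => j; rewrite eq_sym.
  under eq_bigr do rewrite -mulr_sumr -mulr_suml big_split /=.
  rewrite -mulr_sumr -mulr_suml big_split /= exchange_big /= -mulr2n.
  rewrite sumr_const card_ord.
  by rewrite -[_ *+ 2]mulr_natr mulfK ?pnatr_eq0.
apply: le_lt_trans le _.
have -> : q * S + delta * (S *+ K) = S * (delta *+ K + q).
  by rewrite -[S *+ K]mulr_natr -[delta *+ K]mulr_natr; ring.
by rewrite pmulr_rlt0 // -ltrBrDr sub0r.
Qed.

(** Copies of one configuration, translated far apart along a line, interact
    through distances beyond any bound: every block off the diagonal is nearly
    the constant [ginfty >= 0]. Weighting the copies of a negative vector by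
    coefficients of sum zero makes these blocks negligible, which leaves a
    negative space of codimension one in the number of copies. *)
Lemma kappa_minus_unbounded (R : realType) (m : nat) (g : R -> R) (ginfty : R)
    (N : nat) (y : 'I_N -> 'rV[R]_m.+1) (d : nat) :
  g t @[t --> +oo] --> ginfty -> 0 <= ginfty ->
  injective y -> (0 < kappa_minus g y)%N ->
  exists (N' : nat) (x : 'I_N' -> 'rV[R]_m.+1),
    injective x /\ (d <= kappa_minus g x)%N.
Proof.
move=> cvg_g ginfty0 injy /nb_neg_eigenvalues_gt0 [v].
rewrite mx_formE; set q := \sum_p _ => q0.
pose M1 := \sum_p `|v 0 p|.
(* [eta] is the tolerance on [g t - ginfty] for which the errors of all the
   blocks, [M1 ^+ 2 * eta] each, satisfy the bound of [zero_sum_form_lt0]. *)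
pose eta := - q / ((M1 ^+ 2 + 1) * d.+1%:R).
have M0 : 0 < M1 ^+ 2 + 1 by rewrite ltr_wpDl ?sqr_ge0.
have eta0 : 0 < eta by rewrite divr_gt0 ?oppr_gt0 // mulr_gt0.
have etaM : (eta * M1 ^+ 2) *+ d.+1 < - q.
  have -> : (eta * M1 ^+ 2) *+ d.+1 = - q * (M1 ^+ 2 / (M1 ^+ 2 + 1)).
    rewrite -mulr_natr /eta; field.
    by rewrite gt_eqF //= pnatr_eq0.
  by rewrite -[ltRHS]mulr1 ltr_pM2l ?oppr_gt0 // ltr_pdivrMr // mul1r ltrDl.
have [T gT] : exists T, forall t, T < t -> `|g t - ginfty| <= eta.
  move/cvgrPdist_le : cvg_g => /(_ eta eta0) [T [_ HT]].
  by exists T => t /HT; rewrite distrC.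
pose D := \sum_p `|y p 0 0| *+ 2.
have yD p r : `|y p 0 0 - y r 0 0| <= D.
  have le1 l : `|y l 0 0| <= \sum_p `|y p 0 0|.
    by rewrite (bigD1 l) //= lerDl sumr_ge0.
  rewrite (le_trans (ler_normB _ _)) // /D sumrMnl.
  by rewrite -[leRHS]/(_ + _) lerD.
(* With steps of length [L] the points of different copies are more than
   [`|T|] apart already in the first coordinate. *)
pose L := `|T| + D + 1.
have D0 : 0 <= D by rewrite sumr_ge0 // => p _; rewrite mulrn_wge0.
have L0 : 0 <= L by rewrite !addr_ge0.
pose X (z : 'I_d.+1 * 'I_N) : 'rV[R]_m.+1 :=
  y z.2 + ((z.1 : nat)%:R * L) *: delta_mx 0 0.
have X00 z : X z 0 0 = y z.2 0 0 + (z.1 : nat)%:R * L.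
  by rewrite !mxE !eqxx mulr1.
have XT i p j r : i != j -> `|T| < enorm (X (i, p) - X (j, r)).
  move=> ij; apply: lt_le_trans (ler_coord_enorm _ 0).
  have -> : (X (i, p) - X (j, r)) 0 0 =
     (y p 0 0 - y r 0 0) + ((i : nat)%:R - (j : nat)%:R) * L.
    have subE (u w : 'rV[R]_m.+1) : (u - w) 0 0 = u 0 0 - w 0 0.
      by rewrite !mxE.
    by rewrite subE !X00 /=; ring.
  apply: (@lt_le_trans _ _ (L - D)).
    by rewrite /L addrAC addrK ltrDl.
  rewrite [X in `|X|]addrC; apply: le_trans (lerB_normD _ _); rewrite lerB // normrM.
  rewrite (ger0_norm L0) ler_peMl //.
  have := ij; rewrite -val_eqE /= neq_ltn => /orP [lt|lt].
    by rewrite distrC -natrB ?(ltnW lt) // normr_nat ler1n subn_gt0.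
  by rewrite -natrB ?(ltnW lt) // normr_nat ler1n subn_gt0.
have injX : injective X.
  move=> [i p] [j r] E; have [ij|ij] := eqVneq i j.
    by move: E; rewrite ij /X /= => /addIr /injy ->.
  have := XT i p j r ij; rewrite E subrr /enorm big1 ?sqrtr0 => [|l _].
    by rewrite ltNge normr_ge0.
  by rewrite mxE expr0n.
exists #|{: 'I_d.+1 * 'I_N}|, (fun l => X (enum_val l)); split.
  by move=> l l' /injX /enum_val_inj.
(* The rows of [C'] are a basis of the coefficients of sum zero. *)
pose u1 : 'cV[R]_d.+1 := const_mx 1.
pose C' := row_base (kermx u1).
have rC' : (d <= \rank (kermx u1))%N.
  have := rank_leq_col u1; have := rank_leq_row u1.
  by rewrite mxrank_ker => ? ?; lia.
apply: leq_trans rC' _.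
pose C : 'M[R]_(_, #|{: 'I_d.+1 * 'I_N}|) :=
  \matrix_(b, l) (C' b (enum_val l).1 * v 0 (enum_val l).2).
apply: (neg_def_le_nb_neg_eigenvalues (C := C)).
  exact: schoenberg_mx_sym.
move=> a a0; pose c := a *m C'.
have aC l : (a *m C) 0 l = c 0 (enum_val l).1 * v 0 (enum_val l).2.
  rewrite /c !mxE mulr_suml; apply: eq_bigr => b _.
  by rewrite !mxE mulrA.
rewrite mx_formE.
pose G i j := \sum_p \sum_r v 0 p * v 0 r * g (enorm (X (i, p) - X (j, r))).
have -> : \sum_p \sum_r (a *m C) 0 p * (a *m C) 0 r *
    schoenberg_mx g (fun l => X (enum_val l)) p r =
    \sum_i \sum_j c 0 i * c 0 j * G i j.
  pose F z z' := c 0 z.1 * v 0 z.2 * (c 0 z'.1 * v 0 z'.2) *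
    g (enorm (X z - X z')).
  transitivity (\sum_z \sum_z' F z z').
    rewrite [RHS](reindex _ (onW_bij _ (@enum_val_bij _))) /=.
    apply: eq_bigr => l _.
    rewrite [RHS](reindex _ (onW_bij _ (@enum_val_bij _))) /=.
    by apply: eq_bigr => l' _; rewrite !aC [schoenberg_mx _ _ _ _]mxE.
  rewrite -(pair_bigA _ (fun i p => \sum_z' F (i, p) z')) /=.
  apply: eq_bigr => i _.
  under eq_bigr do rewrite -(pair_bigA _ (fun j r => F (i, _) (j, r))) /=.
  rewrite exchange_big /=; apply: eq_bigr => j _.
  rewrite /G mulr_sumr; apply: eq_bigr => p _.
  rewrite mulr_sumr; apply: eq_bigr => r _.
  by rewrite /F /=; ring.
apply: (@zero_sum_form_lt0 _ _ _ _ q (ginfty * (\sum_p v 0 p) ^+ 2) _ _ etaM).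
- by rewrite mulr_ge0 ?sqr_ge0.
- move=> i; apply: eq_bigr => p _; apply: eq_bigr => r _.
  by rewrite mxE /X /= opprD addrACA subrr addr0.
- move=> i j ij.
  have -> : G i j - ginfty * (\sum_p v 0 p) ^+ 2 =
     \sum_p \sum_r v 0 p * v 0 r * (g (enorm (X (i, p) - X (j, r))) - ginfty).
    rewrite expr2 mulr_suml mulr_sumr -sumrB; apply: eq_bigr => p _.
    rewrite mulr_sumr mulr_sumr -sumrB; apply: eq_bigr => r _; ring.
  rewrite (le_trans (ler_norm_sum _ _ _)) // expr2 /M1 mulr_suml mulr_sumr.
  rewrite ler_sum // => p _; rewrite (le_trans (ler_norm_sum _ _ _)) //.
  rewrite !mulr_sumr ler_sum // => r _.
  by rewrite !normrM mulrC ler_wpM2r ?mulr_ge0 // gT // (le_lt_trans (ler_norm T)) // XT.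
- have cu : c *m u1 = 0.
    by apply/sub_kermxP; rewrite (submx_trans (submxMl _ _)) // eq_row_base.
  transitivity ((c *m u1) 0 0); last by rewrite cu mxE.
  by rewrite [RHS]mxE; apply: eq_bigr => i _; rewrite [u1 _ _]mxE mulr1.
- have c0 : c != 0 by rewrite mulmx_free_eq0 ?row_base_free.
  by have /rV0Pn := c0.
Qed.

(** * Averages over an orthogonal action of an abelian group *)

(** [B] is a semidefinite inner product, not assumed to be definite, and [U] an
    action of the abelian group [G] by isometries of it. *)
Section OrthogonalAction.
Context (R : realType) (G : zmodType) (V : lmodType R).
Context (B : V -> {linear V -> R^o}) (U : G -> {linear V -> V}).
Hypothesis Bsym : forall u v, B u v = B v u.
Hypothesis Bge0 : forall u, 0 <= B u u.
Hypothesis U0 : forall u, U 0 u = u.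
Hypothesis UD : forall g h u, U (g + h) u = U g (U h u).
Hypothesis BU : forall g u v, B (U g u) (U g v) = B u v.

Definition seminorm (u : V) : R := Num.sqrt (B u u).
Local Notation nrm := seminorm.

Lemma seminorm_ge0 u : 0 <= nrm u. Proof. exact: sqrtr_ge0. Qed.
#[local] Hint Resolve seminorm_ge0 : core.

Lemma sqr_seminorm u : nrm u ^+ 2 = B u u.
Proof. by rewrite sqr_sqrtr. Qed.

Lemma formDl u v w : B (u + v) w = B u w + B v w.
Proof. by rewrite Bsym linearD /= Bsym (Bsym w). Qed.

Lemma formZl a u w : B (a *: u) w = a * B u w.
Proof. by rewrite Bsym linearZ /= Bsym. Qed.

Lemma formBl u v w : B (u - v) w = B u w - B v w.
Proof. by rewrite formDl -scaleN1r formZl mulN1r. Qed.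

Lemma formZr a u w : B u (a *: w) = a * B u w.
Proof. by rewrite linearZ. Qed.

Lemma form_suml (I : Type) (s : seq I) (F : I -> V) w :
  B (\sum_(i <- s) F i) w = \sum_(i <- s) B (F i) w.
Proof. by rewrite Bsym linear_sum /=; apply: eq_bigr => i _; rewrite Bsym. Qed.

(** The semidefinite case needs more than the discriminant: when [B v v] and
    [B u u] both vanish, [u + v] and [u - v] give the two signs of [B u v]. *)
Lemma cauchy_schwarz u v : `|B u v| <= nrm u * nrm v.
Proof.
rewrite -sqrtrM // -sqrtr_sqr ler_wsqrtr //.
have P a b : 0 <= a ^+ 2 * B u u + 2 * (a * b * B u v) + b ^+ 2 * B v v.
  have := Bge0 (a *: u + b *: v).
  rewrite linearD /= !formZr !formDl !formZl (Bsym v u); congr (_ <= _).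
  by rewrite !expr2; ring.
have := P (B v v) (- B u v); have := P (- B u v) (B u u).
have := P 1 (- B u v); have := P 1 1; have := P 1 (-1).
move: (Bge0 u) (Bge0 v); set x := B u u; set y := B v v; set z := B u v.
move=> x0 y0 h1 h2 h3 h4 h5.
have [yp|yn] := ltP 0 y.
  have : 0 <= y * (x * y - z ^+ 2) by apply: le_trans h5 _; lra.
  by rewrite pmulr_rge0 // subr_ge0.
have y00 : y = 0 by apply/eqP; rewrite eq_le yn y0.
have [xp|xn] := ltP 0 x.
  have : 0 <= x * (x * y - z ^+ 2) by apply: le_trans h4 _; lra.
  by rewrite pmulr_rge0 // subr_ge0.
have x00 : x = 0 by apply/eqP; rewrite eq_le xn x0.
have z0 : z = 0 by apply/eqP; rewrite eq_le; apply/andP; split; lra.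
by rewrite z0 expr0n /= mulr_ge0.
Qed.

Lemma seminormD u v : nrm (u + v) <= nrm u + nrm v.
Proof.
rewrite -(@ler_pXn2r _ 2) ?nnegrE ?addr_ge0 // sqrrD !sqr_seminorm.
rewrite linearD /= !formDl (Bsym v u).
have := cauchy_schwarz u v; have := ler_norm (B u v).
by set x := B u v; set y := nrm u * nrm v; rewrite mulr2n; lra.
Qed.

Lemma seminormZ a u : nrm (a *: u) = `|a| * nrm u.
Proof.
by rewrite /nrm formZr formZl mulrA -expr2 sqrtrM ?sqr_ge0 // sqrtr_sqr.
Qed.

Lemma seminorm0 : nrm 0 = 0.
Proof. by rewrite -(scale0r 0) seminormZ normr0 mul0r. Qed.

Lemma seminormN u : nrm (- u) = nrm u.
Proof. by rewrite -scaleN1r seminormZ normrN1 mul1r. Qed.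

Lemma seminorm_sum (I : Type) (s : seq I) (F : I -> V) :
  nrm (\sum_(i <- s) F i) <= \sum_(i <- s) nrm (F i).
Proof.
elim: s => [|i s IHs]; first by rewrite !big_nil seminorm0.
by rewrite !big_cons (le_trans (seminormD _ _)) // lerD2l.
Qed.

Lemma seminormU g u : nrm (U g u) = nrm u.
Proof. by rewrite /nrm BU. Qed.

Lemma UC g h u : U g (U h u) = U h (U g u).
Proof. by rewrite -!UD addrC. Qed.

Lemma adjU g u v : B (U g u) v = B u (U (- g) v).
Proof. by rewrite -(BU (- g)) -UD addNr U0. Qed.

Definition avg (S : seq G) (u : V) : V :=
  (size S)%:R^-1 *: \sum_(g <- S) U g u.

Lemma avg_is_linear S : linear (avg S).
Proof.
move=> a u v; rewrite /avg scalerA mulrC -scalerA -scalerDr; congr (_ *: _).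
by rewrite scaler_sumr -big_split; apply: eq_bigr => g _; rewrite linearP.
Qed.

HB.instance Definition _ S :=
  GRing.isLinear.Build R V V *:%R (avg S) (avg_is_linear S).

Lemma avgU S g u : avg S (U g u) = U g (avg S u).
Proof.
rewrite /avg linearZ /=; congr (_ *: _); rewrite linear_sum /=.
by apply: eq_bigr => h _; rewrite UC.
Qed.

Lemma avgC S T u : avg S (avg T u) = avg T (avg S u).
Proof.
rewrite {1 4}/avg linearZ /=; congr (_ *: _); rewrite linear_sum /=.
by apply: eq_bigr => g _; rewrite avgU.
Qed.

Lemma seminorm_avg S u : nrm (avg S u) <= nrm u.
Proof.
rewrite /avg seminormZ normfV normr_nat.
have [->|S0] := eqVneq (size S) 0%N; first by rewrite invr0 mul0r.
rewrite mulrC ler_pdivrMr ?ltr0n ?lt0n // mulr_natr.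
rewrite (le_trans (seminorm_sum _ _)) //.
under eq_bigr do rewrite seminormU.
by rewrite big_const_seq count_predT iter_addr_0.
Qed.

Lemma avg_adjoint S u v : B (avg S u) v = B u (avg (map -%R S) v).
Proof.
rewrite /avg size_map formZl formZr big_map; congr (_ * _).
rewrite form_suml linear_sum; apply: eq_bigr => g _; exact: adjU.
Qed.

Lemma avg_sumset S T u :
  avg [seq s + t | s <- S, t <- T] u = avg S (avg T u).
Proof.
rewrite /avg size_allpairs natrM invfM -scalerA; congr (_ *: _).
rewrite big_allpairs_dep /= scaler_sumr; apply: eq_bigr => s _.
rewrite linearZ /=; congr (_ *: _); rewrite linear_sum /=.
by apply: eq_bigr => t _; rewrite UD.
Qed.

Definition progression (N : nat) (b : G) : seq G :=
  [seq b *+ l | l <- iota 0 N].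

(** The multiset of all sums of one term from each progression of step in [bs]:
    averaging over it composes the averages over the progressions, so that it is
    almost invariant under every step at once. Multiplicities matter, which is
    why sequences are used and not sets. *)
Definition progression_sum (N : nat) (bs : seq G) : seq G :=
  foldr (fun b S => [seq s + t | s <- progression N b, t <- S]) [:: 0] bs.

Lemma size_progression_sum N bs :
  size (progression_sum N bs) = (N ^ size bs)%N.
Proof.
elim: bs => // b bs IHbs.
by rewrite /= size_allpairs IHbs size_map size_iota expnS.
Qed.

Lemma opp_progression_sum N bs :
  map -%R (progression_sum N bs) = progression_sum N (map -%R bs).
Proof.
elim: bs => [|b bs IHbs] /=; first by rewrite oppr0.
rewrite -IHbs map_allpairs /progression /= allpairs_mapl allpairs_mapr.
rewrite allpairs_mapl; apply: eq_allpairs => // l s /=.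
by rewrite opprD mulNrn.
Qed.

(** The sum telescopes to the two end terms. *)
Lemma seminorm_avg_progression N b u : (0 < N)%N ->
  nrm (avg (progression N b) (u - U b u)) <= 2 / N%:R * nrm u.
Proof.
move=> N0; rewrite /avg /progression big_map size_map size_iota.
have -> : \sum_(l <- iota 0 N) U (b *+ l) (u - U b u) = u - U (b *+ N) u.
  elim: N {N0} => [|N IHN]; first by rewrite big_nil mulr0n U0 subrr.
  rewrite -addn1 iotaD add0n big_cat big_seq1 IHN /=.
  by rewrite linearB /= -UD -mulrSr addn1 addrA subrK.
rewrite seminormZ normfV normr_nat mulrAC mulrC.
rewrite ler_wpM2r ?invr_ge0 ?ler0n // (le_trans (seminormD _ _)) //.
by rewrite seminormN seminormU; lra.
Qed.

Definition almost_invariant (S : seq G) (b : G) (delta : R) : Prop :=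
  forall u, nrm (avg S (u - U b u)) <= delta * nrm u.

Lemma almost_invariant_progression_sum N bs b : (0 < N)%N -> b \in bs ->
  almost_invariant (progression_sum N bs) b (2 / N%:R).
Proof.
move=> N0; elim: bs => //= c bs IHbs; rewrite inE => bin u.
rewrite avg_sumset; have [<-|bc] := eqVneq b c; last first.
  apply: le_trans (seminorm_avg _ _) _; apply: IHbs.
  by move: bin; rewrite (negPf bc).
by rewrite avgC (le_trans (seminorm_avg _ _)) ?seminorm_avg_progression.
Qed.

Lemma almost_invariantN S b delta :
  almost_invariant S (- b) delta -> almost_invariant S b delta.
Proof.
move=> inv u; have := inv (U b u); rewrite -UD addNr U0 seminormU.
by rewrite -opprB linearN seminormN.
Qed.

Lemma almost_invariant_opp_progression_sum N bs b : (0 < N)%N -> b \in bs ->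
  almost_invariant (map -%R (progression_sum N bs)) b (2 / N%:R).
Proof.
move=> N0 bin; apply: almost_invariantN; rewrite opp_progression_sum.
by apply: almost_invariant_progression_sum => //; rewrite map_f.
Qed.

(** A linear map that hardly distinguishes [k] from its translates sends [k] to
    about the same vector as any combination of mass one of the translates. *)
Lemma linear_mass1 (L : {linear V -> V}) (mu : seq (R * G)) (k : V) :
  \sum_(p <- mu) p.1 = 1 ->
  L k = L (\sum_(p <- mu) p.1 *: U p.2 k)
        + \sum_(p <- mu) p.1 *: L (k - U p.2 k).
Proof.
move=> mass; rewrite linear_sum -big_split -[in LHS](scale1r k) -mass /=.
rewrite scaler_suml linear_sum; apply: eq_bigr => p _.
by rewrite !linearZ -scalerDr -linearD addrC subrK.
Qed.

(** Taking the adjoint moves the average over [T] to the other side, so the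
    quantity is controlled by the double average of [k] over [S] and [- T]. This
    double average is almost invariant under [a + b] whenever the first average
    is under [a] and the second under [b], hence maps [k] to nearly the image of
    the short vector [\sum_p p.1 *: U p.2 k]. *)
Lemma form_avg_small (mu : seq (R * G)) (k : V) (S T : seq G) (eps delta : R)
    (x y : G) :
  \sum_(p <- mu) p.1 = 1 ->
  nrm (\sum_(p <- mu) p.1 *: U p.2 k) <= eps ->
  (forall p, p \in mu -> exists a b, [/\ p.2 = a + b,
     almost_invariant S a delta & almost_invariant (map -%R T) b delta]) ->
  `|B (U x (avg S k)) (U y (avg T k))| <=
    nrm k * (eps + 2 * delta * nrm k * \sum_(p <- mu) `|p.1|).
Proof.
move=> mass small inv.
rewrite -avgU Bsym -avgU avg_adjoint.
apply: le_trans (cauchy_schwarz _ _) _; rewrite seminormU ler_wpM2l //.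
rewrite !avgU seminormU.
have := linear_mass1 (avg (map -%R T) \o avg S) k mass.
rewrite /= => ->; apply: le_trans (seminormD _ _) _; rewrite lerD //.
  by rewrite (le_trans (seminorm_avg _ _)) // (le_trans (seminorm_avg _ _)).
rewrite (le_trans (seminorm_sum _ _)) // mulr_sumr !big_seq ler_sum //= => p pin.
rewrite seminormZ mulrC ler_wpM2r //.
have [a [b [-> invS invT]]] := inv p pin.
have -> : k - U (a + b) k = (k - U a k) + U a (k - U b k).
  by rewrite UD linearB /= addrA subrK.
rewrite linearD /= linearD /= (le_trans (seminormD _ _)) //.
have -> : 2 * delta * nrm k = delta * nrm k + delta * nrm k by ring.
rewrite lerD //.
  by rewrite (le_trans (seminorm_avg _ _)).
by rewrite avgC (le_trans (seminorm_avg _ _)) // avgU seminormU.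
Qed.

End OrthogonalAction.

(** * Radial coefficients of an action of the plane *)

Definition norm2 (R : realType) (p : R * R) : R :=
  Num.sqrt (p.1 ^+ 2 + p.2 ^+ 2).

(** The inner products of the translates of [k] are a radial kernel, with profile
    [h]. *)
Section PlaneAction.
Context (R : realType) (V : lmodType R).
Context (B : V -> {linear V -> R^o}) (U : R * R -> {linear V -> V}).
Hypothesis Bsym : forall u v, B u v = B v u.
Hypothesis Bge0 : forall u, 0 <= B u u.
Hypothesis U0 : forall u, U 0 u = u.
Hypothesis UD : forall g h u, U (g + h) u = U g (U h u).
Hypothesis BU : forall g u v, B (U g u) (U g v) = B u v.
Context (k : V) (h : R -> R).
Hypothesis Bk : forall x y, B (U x k) (U y k) = h (norm2 (x - y)).
Hypothesis h_cont0 : forall eps, 0 < eps ->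
  exists2 delta, 0 < delta & forall t, 0 <= t < delta -> h 0 - h t <= eps.
Hypothesis small_mass1 : forall eps, 0 < eps ->
  exists mu : seq (R * (R * R)), \sum_(p <- mu) p.1 = 1 /\
    seminorm B (\sum_(p <- mu) p.1 *: U p.2 k) <= eps.

Local Notation nrm := (seminorm B).

Lemma norm2_axis (r : R) : norm2 (r, 0) = `|r|.
Proof. by rewrite /norm2 /= expr0n addr0 sqrtr_sqr. Qed.

Lemma Bkk : B k k = h 0.
Proof. by rewrite -(BU 0) Bk subrr norm2_axis normr0. Qed.

(** Krein's inequality: [h r - h s] is the inner product of [k] with the
    difference of two translates of [k], whose squared length is
    [2 * (h 0 - h `|r - s|)]. *)
Lemma radial_uniformly_continuous eps : 0 < eps ->
  exists2 delta, 0 < delta &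
    forall r s, 0 <= r -> 0 <= s -> `|r - s| < delta -> `|h r - h s| <= eps.
Proof.
move=> eps0; have k1 : 0 < nrm k + 1 by rewrite ltr_wpDl ?seminorm_ge0.
have e0 : 0 < (eps / (nrm k + 1)) ^+ 2 / 2 by rewrite divr_gt0 ?exprn_gt0 ?divr_gt0.
have [delta d0 hd] := h_cont0 e0; exists delta => // r s r0 s0 rs.
have hE t : 0 <= t -> h t = B (U (t, 0) k) k.
  by move=> t0; rewrite -[in RHS](U0 k) -UD addr0 Bk subr0 norm2_axis ger0_norm.
pose u := U (r, 0) k - U (s, 0) k.
have -> : h r - h s = B u k.
  by rewrite (hE r) // (hE s) // /u (formBl Bsym).
apply: le_trans (cauchy_schwarz Bsym Bge0 _ _) _.
have nu : nrm u <= eps / (nrm k + 1).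
  rewrite -(@ler_pXn2r _ 2) ?nnegrE ?seminorm_ge0 ?divr_ge0 ?(ltW eps0) ?(ltW k1) //.
  rewrite sqr_seminorm // /u linearB /= !(formBl Bsym) !BU Bkk.
  rewrite (Bsym (U (s, 0) k)) Bk.
  have -> : norm2 ((r, 0) - (s, 0)) = `|r - s|.
    by rewrite -norm2_axis; congr norm2; congr pair; rewrite /= subr0.
  have : h 0 - h `|r - s| <= (eps / (nrm k + 1)) ^+ 2 / 2.
    by rewrite hd // normr_ge0.
  by lra.
apply: (@le_trans _ _ (eps / (nrm k + 1) * nrm k)).
  by rewrite ler_wpM2r ?seminorm_ge0.
rewrite mulrAC ler_pdivrMr // ler_wpM2l ?(ltW eps0) //.
by rewrite lerDl.
Qed.

Definition orth (n p : R * R) : Prop := n.1 * p.1 + n.2 * p.2 = 0.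

Lemma orth_progression_sum n N bs :
  (forall b, b \in bs -> orth n b) ->
  forall s, s \in progression_sum N bs -> orth n s.
Proof.
elim: bs => [_ s|b bs IHbs H s].
  by rewrite inE => /eqP ->; rewrite /orth !mulr0 addr0.
case/allpairsP => -[x y] /= [/mapP [l _ ->] ybs ->].
have yo : orth n y by apply: (IHbs _ y ybs) => c cbs; apply: H; rewrite inE cbs orbT.
have : orth n b by apply: H; rewrite inE eqxx.
move: yo; rewrite /orth /=; case: b y {H IHbs ybs} => [b1 b2] [y1 y2] /=.
have -> : ((b1, b2) *+ l) = (b1 *+ l, b2 *+ l).
  by elim: l => // l; rewrite !mulrS => ->.
move=> /= yo bo; rewrite -[b1 *+ l]mulr_natr -[b2 *+ l]mulr_natr.
by rewrite -[RHS](addr0 0) -{1}yo -(mul0r (l%:R : R)) -bo; ring.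
Qed.

(** Pythagoras: the distance is [sqrt (t ^ 2 + |p| ^ 2)]. *)
Lemma norm2_orth n p t : norm2 n = 1 -> orth n p -> 0 < t ->
  t <= norm2 (t * n.1 + p.1, t * n.2 + p.2) <= t + norm2 p ^+ 2 / t.
Proof.
move=> n1 np t0.
have pE : norm2 p ^+ 2 = p.1 ^+ 2 + p.2 ^+ 2.
  by rewrite sqr_sqrtr // addr_ge0 ?sqr_ge0.
have nE : n.1 ^+ 2 + n.2 ^+ 2 = 1.
  have := congr1 (fun x => x ^+ 2) n1.
  by rewrite /norm2 sqr_sqrtr ?addr_ge0 ?sqr_ge0 // expr1n.
have E : (t * n.1 + p.1) ^+ 2 + (t * n.2 + p.2) ^+ 2 = t ^+ 2 + norm2 p ^+ 2.
  rewrite pE -[X in X + _ = _]subr0.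
  have -> : t ^+ 2 = t ^+ 2 * (n.1 ^+ 2 + n.2 ^+ 2) + 2 * t * (n.1 * p.1 + n.2 * p.2).
    by rewrite nE np; ring.
  by ring.
rewrite /norm2 /= E; apply/andP; split.
  by rewrite -[leLHS](ger0_norm (ltW t0)) -sqrtr_sqr ler_wsqrtr // lerDl sqr_ge0.
rewrite -[leRHS]ger0_norm ?addr_ge0 ?divr_ge0 ?sqr_ge0 ?(ltW t0) //.
rewrite -sqrtr_sqr ler_wsqrtr // sqrrD -addrA lerD2l.
rewrite mulrCA divff ?gt_eqF // mulr1 mulr2n -addrA lerDl addr_ge0 ?sqr_ge0 //.
Qed.

(** The points [t n + s], with [s] in the finite set [S] orthogonal to [n], are at
    a distance [t + O(1 / t)] from the origin, so the average is one of values of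
    [h] close to [h t]. *)
Lemma form_avg_orth n (S : seq (R * R)) eps : norm2 n = 1 -> (0 < size S)%N ->
  (forall s, s \in S -> orth n s) -> 0 < eps ->
  exists T, forall t, T < t ->
    `|h t - B k (U (t * n.1, t * n.2) (avg U S k))| <= eps.
Proof.
move=> n1 S0 So eps0.
have [delta d0 hd] := radial_uniformly_continuous eps0.
pose K := \sum_(s <- S) norm2 s ^+ 2.
have K0 : 0 <= K by rewrite sumr_ge0 // => s _; exact: sqr_ge0.
exists ((K + 1) / delta) => t Tt.
have t0 : 0 < t by apply: lt_trans Tt; rewrite divr_gt0 // ltr_wpDl.
have SN : 0 < (size S)%:R :> R by rewrite ltr0n.
have -> : h t - B k (U (t * n.1, t * n.2) (avg U S k)) =
    (size S)%:R^-1 * \sum_(s <- S) (h t - h (norm2 (t * n.1 + s.1, t * n.2 + s.2))).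
  rewrite big_split /= sumrN big_const_seq count_predT iter_addr_0.
  rewrite mulrDr -[h t *+ _]mulr_natl mulKf ?gt_eqF // mulrN; congr (_ - _).
  rewrite /avg linearZ /= linearZ /=; congr (_ * _).
  rewrite linear_sum /= linear_sum /=; apply: eq_bigr => s _.
  rewrite -UD -{1}(U0 k) Bk; congr h.
  by rewrite /norm2 sub0r /= !sqrrN.
rewrite normrM normfV (gtr0_norm SN) mulrC ler_pdivrMr //.
rewrite (le_trans (ler_norm_sum _ _ _)) //.
apply: (@le_trans _ _ (\sum_(s <- S) eps)); last first.
  by rewrite big_const_seq count_predT iter_addr_0 mulr_natr.
rewrite !big_seq ler_sum // => s sS.
have /andP[le1 le2] := norm2_orth n1 (So s sS) t0.
apply: hd; [exact: ltW|exact: sqrtr_ge0|].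
rewrite distrC ger0_norm ?subr_ge0 // ltrBlDl.
apply: le_lt_trans le2 _; rewrite ltrD2l ltr_pdivrMr //.
have sK : norm2 s ^+ 2 <= K.
  by rewrite /K (big_rem s) //= lerDl sumr_ge0 // => p _; exact: sqr_ge0.
apply: le_lt_trans sK _; move: Tt; rewrite ltr_pdivrMr // mulrC.
by apply: lt_trans; rewrite ltrDl.
Qed.

(** Unit normal to the direction [(1, i)]. *)
Definition slope_normal (i : nat) : R * R :=
  let s := Num.sqrt (1 + i%:R ^+ 2) in (- i%:R / s, 1 / s).

Lemma norm2_slope_normal i : norm2 (slope_normal i) = 1.
Proof.
have p : 0 < 1 + i%:R ^+ 2 :> R by rewrite ltr_pwDl ?sqr_ge0.
rewrite /norm2 /slope_normal /= !expr_div_n sqr_sqrtr ?(ltW p) // sqrrN.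
by rewrite -mulrDl addrC expr1n divff ?sqrtr1 // gt_eqF.
Qed.

(** Component of [a] along [(1, i)] in the basis formed by [(1, i)] and [(1, j)],
    by Cramer's rule. *)
Definition slope_part (i j : nat) (a : R * R) : R * R :=
  let c := (a.1 * j%:R - a.2) / (j%:R - i%:R) in (c, c * i%:R).

Lemma orth_slope_part i j a : orth (slope_normal i) (slope_part i j a).
Proof. by rewrite /orth /slope_normal /slope_part /=; ring. Qed.

Lemma slope_partK i j a : i != j -> a = slope_part i j a + slope_part j i a.
Proof.
move=> ij; have ij0 : (j%:R - i%:R : R) != 0.
  by rewrite subr_eq0 eqr_nat eq_sym.
have ji0 : (i%:R - j%:R : R) != 0 by rewrite subr_eq0 eqr_nat.
by case: a => a1 a2; congr pair; rewrite /=; field; rewrite ij0 ji0.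
Qed.

(** For large [t] and each of [m] directions, [h t] is nearly the inner product of
    [k] with the translate by [t n_i] of an average of [k]. These [m] vectors are
    almost orthogonal and no longer than [k], so that their sum [W] has length
    about [sqrt m] times that of [k], whereas [B k W] is nearly [m * h t]. *)
Theorem radial_vanishes_at_infinity eta : 0 < eta ->
  exists T, forall t, T < t -> `|h t| <= eta.
Proof.
move=> eta0; set kk := nrm k.
have kk0 : 0 <= kk := seminorm_ge0 B k.
have h0E : h 0 = kk ^+ 2 by rewrite -Bkk sqr_seminorm.
pose eps0 := eta ^+ 2 / (8 * (kk ^+ 2 + 1)).
have k21 : 0 < kk ^+ 2 + 1 by rewrite ltr_wpDl ?sqr_ge0.
have e00 : 0 < eps0 by rewrite divr_gt0 ?exprn_gt0 // mulr_gt0.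
(* [m] and [eps0] are such that [|k| ^ 2 * |W| ^ 2 <= (m * eta / 2) ^ 2], where
   the diagonal and the cross terms of [|W| ^ 2] take one half each. *)
have [m mP] : exists m : nat, 8 * kk ^+ 4 / eta ^+ 2 < m%:R.
  by eexists; exact: truncnS_gt.
have m0 : 0 < m%:R :> R.
  by apply: le_lt_trans mP; rewrite divr_ge0 ?mulr_ge0 ?exprn_ge0 // ltW.
have [mu [mass muS]] : exists mu : seq (R * (R * R)), \sum_(p <- mu) p.1 = 1 /\
    nrm (\sum_(p <- mu) p.1 *: U p.2 k) <= eps0 / (2 * (kk + 1)).
  by apply: small_mass1; rewrite divr_gt0 // mulr_gt0 // ltr_wpDl.
pose M := \sum_(p <- mu) `|p.1|.
have M0 : 0 <= M by rewrite sumr_ge0.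
(* [N] makes the lack of invariance cost at most [eps0 / 2] in a cross term. *)
have [N NP] : exists N : nat, 8 * kk ^+ 2 * M / eps0 < N%:R.
  by eexists; exact: truncnS_gt.
have N0 : 0 < N%:R :> R.
  by apply: le_lt_trans NP; rewrite divr_ge0 ?(ltW e00) // !mulr_ge0 ?sqr_ge0.
have N0' : (0 < N)%N by rewrite -(ltr0n R).
pose bs i := [seq slope_part i j p.2 | j <- iota 0 m, p <- mu].
pose S i := progression_sum N (bs i).
have Sorth i s : s \in S i -> orth (slope_normal i) s.
  apply: orth_progression_sum => b /allpairsP [[j p] /= [_ _ ->]].
  exact: orth_slope_part.
have S0 i : (0 < size (S i))%N by rewrite size_progression_sum expn_gt0 N0'.
have bsP i j p : (j < m)%N -> p \in mu -> slope_part i j p.2 \in bs i.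
  by move=> jm pm; apply/allpairsP; exists (j, p); split; rewrite //= mem_iota.
have cross (i j : 'I_m) x y : i != j ->
    B (U x (avg U (S i) k)) (U y (avg U (S j) k)) <= eps0.
  move=> ij; apply: le_trans (ler_norm _) _.
  have inv p : p \in mu -> exists a b, [/\ p.2 = a + b,
     almost_invariant B U (S i) a (2 / N%:R) &
     almost_invariant B U (map -%R (S j)) b (2 / N%:R)].
    move=> pm; exists (slope_part i j p.2), (slope_part j i p.2); split.
    - exact: slope_partK.
    - by apply: almost_invariant_progression_sum => //; exact: bsP.
    - by apply: almost_invariant_opp_progression_sum => //; exact: bsP.
  have := form_avg_small Bsym Bge0 U0 UD BU x y mass muS inv.
  move=> /le_trans; apply; rewrite -/kk -/M.
  have le1 : kk * (eps0 / (2 * (kk + 1))) <= eps0 / 2.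
    rewrite mulrA ler_pdivrMr ?mulr_gt0 ?ltr_wpDl //.
    have -> : eps0 / 2 * (2 * (kk + 1)) = kk * eps0 + eps0 by field.
    by rewrite lerDl ltW.
  have le2 : kk * (2 * (2 / N%:R) * kk * M) <= eps0 / 2.
    have -> : kk * (2 * (2 / N%:R) * kk * M) = (4 * kk ^+ 2 * M) / N%:R.
      by field; rewrite gt_eqF.
    rewrite ler_pdivrMr //; move: NP; rewrite ltr_pdivrMr //.
    by move=> /ltW; lra.
  by rewrite mulrDr; lra.
have /choice [T TP] : forall i : 'I_m, exists T, forall t, T < t ->
    `|h t - B k (U (t * (slope_normal i).1, t * (slope_normal i).2)
       (avg U (S i) k))| <= eta / 2.
  move=> i; apply: form_avg_orth; rewrite ?norm2_slope_normal ?divr_gt0 //.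
  exact: Sorth.
exists (\sum_i `|T i|) => t Tt.
have Tlt i : T i < t.
  apply: le_lt_trans Tt; rewrite (le_trans (ler_norm _)) // (bigD1 i) //=.
  by rewrite lerDl sumr_ge0.
pose u i := U (t * (slope_normal i).1, t * (slope_normal i).2) (avg U (S i) k).
pose W := \sum_(i < m) u i.
have W2 : nrm W ^+ 2 <= kk ^+ 2 *+ m + eps0 *+ m *+ m.
  rewrite sqr_seminorm // /W form_suml //.
  have -> : kk ^+ 2 *+ m + eps0 *+ m *+ m =
     \sum_(i < m) \sum_(j < m) ((if i == j then kk ^+ 2 else 0) + eps0).
    under eq_bigr do rewrite big_split /= sumr_const card_ord.
    rewrite big_split /= sumr_const card_ord; congr (_ + _).
    rewrite -[in LHS](card_ord m) -sumr_const; apply: eq_bigr => i _.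
    by rewrite -big_mkcond /= (big_pred1 i) // => j; rewrite eq_sym.
  rewrite ler_sum // => i _; rewrite linear_sum /= ler_sum // => j _.
  have [<-|ij] := eqVneq i j; last by rewrite add0r cross.
  rewrite -sqr_seminorm // -[leLHS]addr0 lerD ?(ltW e00) //.
  rewrite ler_pXn2r ?nnegrE ?seminorm_ge0 // /u seminormU //.
  exact: seminorm_avg.
have kW : kk * nrm W <= m%:R * eta / 2.
  rewrite -(@ler_pXn2r _ 2) ?nnegrE ?mulr_ge0 ?seminorm_ge0 ?invr_ge0 ?ler0n //;
    last exact: ltW.
  rewrite exprMn; apply: (@le_trans _ _ (kk ^+ 2 * (kk ^+ 2 *+ m + eps0 *+ m *+ m))).
    by rewrite ler_wpM2l ?sqr_ge0.
  have le1 : kk ^+ 4 <= m%:R * eta ^+ 2 / 8.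
    by move: mP; rewrite ltr_pdivrMr ?exprn_gt0 // => /ltW; lra.
  have le2 : kk ^+ 2 * eps0 <= eta ^+ 2 / 8.
    rewrite mulrA ler_pdivrMr ?mulr_gt0 //.
    have := ltW (exprn_gt0 2 eta0); set e := eta ^+ 2; set c := kk ^+ 2.
    by move=> e0; lra.
  have -> : kk ^+ 2 * (kk ^+ 2 *+ m + eps0 *+ m *+ m) =
     m%:R * kk ^+ 4 + m%:R ^+ 2 * (kk ^+ 2 * eps0).
    by rewrite -[_ *+ m *+ m]mulr_natr -[eps0 *+ m]mulr_natr -[kk ^+ 2 *+ m]mulr_natr; ring.
  apply: (@le_trans _ _ (m%:R * (m%:R * eta ^+ 2 / 8) + m%:R ^+ 2 * (eta ^+ 2 / 8))).
    by rewrite lerD // ler_wpM2l ?exprn_ge0 ?ler0n.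
  by rewrite le_eqVlt; apply/orP; left; apply/eqP; field.
have : m%:R * `|h t| <= m%:R * eta.
  have -> : m%:R * `|h t| = `|\sum_(i < m) (h t - B k (u i)) + B k W|.
    rewrite /W linear_sum /= -big_split /=.
    under eq_bigr do rewrite subrK.
    by rewrite sumr_const card_ord normrMn mulr_natl.
  apply: le_trans (ler_normD _ _) _.
  have -> : m%:R * eta = m%:R * (eta / 2) + m%:R * eta / 2 by field.
  apply: lerD; last exact: le_trans (cauchy_schwarz Bsym Bge0 _ _) kW.
  apply: le_trans (ler_norm_sum _ _ _) _.
  apply: (@le_trans _ _ (\sum_(i < m) eta / 2)); last first.
    by rewrite sumr_const card_ord mulr_natl.
  by apply: ler_sum => i _; exact: TP.
by rewrite ler_pM2l.
Qed.

End PlaneAction.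

(** * Positive definite radial functions have a limit at infinity *)

(** The form is realised on the free vector space on the points, that is on
    finitely supported signed measures, on which the group acts by translation. *)
Section FreeModuleForm.
Context (R : realType) (G : zmodType).
Local Notation V := {freeg G / R}.

Lemma fgliftE (M : lmodType R) (f : G -> M) (u : V) :
  fglift f u = \sum_(z <- dom u) coeff z u *: f z.
Proof.
rewrite -{1}(Freeg_dom u) fglift_Freeg /prelift big_map.
by apply: eq_bigr.
Qed.

HB.instance Definition _ (M : lmodType R) (f : G -> M) :=
  GRing.isZmodMorphism.Build V M (fglift f) (lift_is_additive f).

Lemma fglift_is_scalable (M : lmodType R) (f : G -> M) :
  scalable (fglift f : V -> M).
Proof.
move=> a u; rewrite [RHS](congr1 _ (fgliftE f u)) scaler_sumr.
have -> : a *: u = \sum_(z <- dom u) << a * coeff z u *g z >> by [].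
by rewrite raddf_sum /=; apply: eq_bigr => z _; rewrite liftU scalerA.
Qed.

HB.instance Definition _ (M : lmodType R) (f : G -> M) :=
  GRing.isScalable.Build R V M *:%R (fglift f) (fglift_is_scalable f).

Definition translation (g : G) : {linear V -> V} :=
  fglift (fun x => << x + g >> : V).

Lemma fglift_translation (M : lmodType R) (f : G -> M) g u :
  fglift f (translation g u) = fglift (fun x => f (x + g)) u.
Proof.
rewrite /translation /= (fgliftE _ u) linear_sum [RHS]fgliftE.
by apply: eq_bigr => z _; rewrite linearZ /= liftU scale1r.
Qed.

Lemma translation0 u : translation 0 u = u.
Proof.
rewrite /translation /= fgliftE -[RHS]freeg_sumE; apply: eq_bigr => z _.
apply/eqP/freeg_eqP => x; rewrite coeffZ !coeffU addr0 mul1r //.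
Qed.

Lemma translationD g h u :
  translation (g + h) u = translation g (translation h u).
Proof.
rewrite [RHS]fglift_translation; congr (fglift _ u).
by apply: funext => x; rewrite addrCA addrC.
Qed.

Definition kernel_form (K : G -> G -> R) (u : V) : {linear V -> R^o} :=
  fglift (fun y => fglift (fun x => K x y : R^o) u : R^o).

Lemma kernel_formE K u v : kernel_form K u v =
  \sum_(x <- dom u) \sum_(y <- dom v) coeff x u * coeff y v * K x y.
Proof.
rewrite /kernel_form /= fgliftE exchange_big; apply: eq_bigr => y _ /=.
rewrite fgliftE scaler_sumr; apply: eq_bigr => x _ /=.
by rewrite /GRing.scale /= mulrCA mulrA.
Qed.

Lemma kernel_formC K u v : (forall x y, K x y = K y x) ->
  kernel_form K u v = kernel_form K v u.
Proof.
move=> KC; rewrite !kernel_formE exchange_big; apply: eq_bigr => y _ /=.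
by apply: eq_bigr => x _; rewrite KC [coeff x u * _]mulrC.
Qed.

Lemma kernel_form_translation K g u v :
  (forall x y, K (x + g) (y + g) = K x y) ->
  kernel_form K (translation g u) (translation g v) = kernel_form K u v.
Proof.
move=> Kg; rewrite /kernel_form /= fglift_translation; congr (fglift _ v).
apply: funext => y; rewrite fglift_translation; congr (fglift _ u).
exact: funext.
Qed.

Lemma kernel_formU K x y : kernel_form K << x >> << y >> = K x y.
Proof. by rewrite /kernel_form /= !liftU !scale1r. Qed.

Lemma translationU g x : translation g << x >> = << x + g >>.
Proof. by rewrite /translation /= liftU scale1r. Qed.

Definition mass (u : V) : R := fglift (fun _ => 1 : R^o) u.

Lemma massE u : mass u = \sum_(x <- dom u) coeff x u.
Proof. by rewrite /mass fgliftE; apply: eq_bigr => x _; apply: mulr1. Qed.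

Lemma massZ a u : mass (a *: u) = a * mass u.
Proof. by rewrite /mass linearZ. Qed.

Lemma sum_translation_origin u :
  \sum_(z <- dom u) coeff z u *: translation z << 0 >> = u.
Proof.
rewrite -[RHS]freeg_sumE; apply: eq_bigr => z _.
by apply/eqP/freeg_eqP => x; rewrite translationU coeffZ !coeffU add0r mul1r.
Qed.

Lemma kernel_form_subc K c u :
  kernel_form (fun x y => K x y - c) u u = kernel_form K u u - c * mass u ^+ 2.
Proof.
rewrite !kernel_formE massE expr2 mulr_suml mulr_sumr -sumrB.
apply: eq_bigr => x _; rewrite !mulr_sumr -sumrB; apply: eq_bigr => y _.
by ring.
Qed.

End FreeModuleForm.

Lemma Phi_form_ge0 (R : realType) n (f : R -> R) N (x : 'I_N -> 'rV[R]_n)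
    (a : 'I_N -> R) : Phi n f -> injective x ->
  0 <= \sum_i \sum_j a i * a j * f (enorm (x i - x j)).
Proof.
move=> [_ Pf] injx; have := Pf N x (fun i => real_complex R (a i)) injx.
rewrite -ler0c rmorph_sum /=; congr (0 <= _); apply: eq_bigr => i _.
rewrite rmorph_sum /=; apply: eq_bigr => j _.
have -> : a i * a j * f (enorm (x i - x j)) =
  f (enorm (x i - x j)) * a j * a i by ring.
by rewrite !rmorphM /=; congr (_ * _); apply: conjc_real.
Qed.

Definition plane_embedding (R : realType) n (p : R * R) : 'rV[R]_n.+2 :=
  \row_j (if j == 0 then p.1 else if j == 1 then p.2 else 0).

Lemma enorm_plane_embedding (R : realType) n (p q : R * R) :
  enorm (plane_embedding n p - plane_embedding n q) = norm2 (p - q).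
Proof.
rewrite /enorm /norm2 !big_ord_recl big1 => [|j _]; last first.
  by rewrite !mxE /= subr0 expr0n.
by rewrite addr0 !mxE.
Qed.

Lemma plane_embedding_inj (R : realType) n : injective (@plane_embedding R n).
Proof.
move=> [a b] [c d] /rowP E; have := E 0; have := E 1; rewrite !mxE /=.
by move=> -> ->.
Qed.

(** The limit [c] is the infimum of the energy over measures of mass one.
    Subtracting it from the kernel keeps the form nonnegative, by homogeneity,
    and makes some measures of mass one arbitrarily short. *)
Lemma Phi_cvg_pinfty (R : realType) n (f : R -> R) : Phi n.+2 f ->
  exists2 c : R, 0 <= c & f t @[t --> +oo] --> c.
Proof.
move=> Pf; have [cf _] := Pf.
pose F (x y : R * R) := f (norm2 (x - y)).
have norm2C (x y : R * R) : norm2 (x - y) = norm2 (y - x).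
  by rewrite -opprB /norm2 /= !sqrrN.
have F_ge0 u : 0 <= kernel_form F u u.
  rewrite kernel_formE (big_nth 0) big_mkord.
  under eq_bigr do rewrite (big_nth 0) big_mkord.
  pose x (i : 'I_(size (dom u))) := plane_embedding n (nth 0 (dom u) i).
  have injx : injective x.
    move=> i j /plane_embedding_inj /eqP.
    by rewrite nth_uniq ?uniq_dom // => /eqP/val_inj.
  have := Phi_form_ge0 (fun i => coeff (nth 0 (dom u) i) u) Pf injx.
  congr (0 <= _); apply: eq_bigr => i _; apply: eq_bigr => j _.
  by rewrite /F enorm_plane_embedding.
pose E : set R := [set kernel_form F u u | u in [set u | mass u = 1]].
have E0 : E (F 0 0).
  exists << 0 >>; last exact: kernel_formU.
  by rewrite /= /mass liftU scale1r.
have infE : has_inf E.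
  split; first by exists (F 0 0).
  by exists 0 => _ [u _ <-].
pose c := inf E.
have c0 : 0 <= c by apply: lb_le_inf; [exists (F 0 0) | move=> _ [u _ <-]].
exists c => //.
pose H (x y : R * R) := F x y - c.
have FC u v : kernel_form F u v = kernel_form F v u.
  by apply: kernel_formC => x y; rewrite /F norm2C.
have H_ge0 u : 0 <= kernel_form H u u.
  rewrite kernel_form_subc; have [->|u0] := eqVneq (mass u) 0.
    by rewrite expr0n mulr0 subr0.
  have : c <= kernel_form F ((mass u)^-1 *: u) ((mass u)^-1 *: u).
    apply: ge_inf; first by case: infE.
    by exists ((mass u)^-1 *: u) => //=; rewrite massZ mulVf.
  move=> cle; have -> : kernel_form F u u = mass u ^+ 2 *
      kernel_form F ((mass u)^-1 *: u) ((mass u)^-1 *: u).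
    rewrite linearZ /= (FC (_ *: u)) linearZ /= /GRing.scale /=.
    by field.
  by rewrite [c * _]mulrC -mulrBr mulr_ge0 ?sqr_ge0 // subr_ge0.
have HC x y : H x y = H y x by rewrite /H /F norm2C.
have HT g x y : H (x + g) (y + g) = H x y.
  by rewrite /H /F opprD addrACA subrr addr0.
pose h t := f t - c.
have Hcont eps : 0 < eps ->
    exists2 delta, 0 < delta & forall t, 0 <= t < delta -> h 0 - h t <= eps.
  move=> eps0; move/subspace_continuousP : cf => /(_ 0).
  rewrite /= in_itv /= lexx => /(_ isT) /cvgrPdist_le /(_ eps eps0).
  rewrite near_withinE => /nbhs_ballP [delta /= d0 hd].
  exists delta => // t /andP[t0 td].
  rewrite /h opprB addrA subrK; apply: le_trans (ler_norm _) _; apply: hd.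
    by rewrite /ball /= sub0r normrN ger0_norm.
  by rewrite /= in_itv /= t0.
have small eps : 0 < eps -> exists mu : seq (R * (R * R)),
    \sum_(p <- mu) p.1 = 1 /\
    seminorm (kernel_form H) (\sum_(p <- mu) p.1 *: translation R p.2 << 0 >>)
      <= eps.
  move=> eps0.
  have [_ [u u1 <-] ulim] := inf_adherent (exprn_gt0 2 eps0) infE.
  exists [seq (coeff z u, z) | z <- dom u]; split.
    by rewrite big_map -massE.
  rewrite big_map sum_translation_origin.
  rewrite -[leRHS](ger0_norm (ltW eps0)) -sqrtr_sqr ler_wsqrtr //.
  by rewrite kernel_form_subc u1 expr1n mulr1 lerBlDl; apply: ltW.
have := @radial_vanishes_at_infinity R _ (kernel_form H) (@translation R _)
  (fun u v => kernel_formC u v HC) H_ge0 (@translation0 R _)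
  (@translationD R _) (fun g u v => kernel_form_translation u v (HT g))
  << 0 >> h _ Hcont small.
move=> vanish; apply/cvgrPdist_le => eps eps0.
have [|T HT'] := vanish _ eps eps0.
  by move=> x y; rewrite !translationU kernel_formU !add0r.
exists T; split; first exact: num_real.
by move=> t /HT'; rewrite distrC.
Qed.

(** * Infinitely many negative squares *)

(** The imaginary part of the complex form is antisymmetric in the two indices
    and sums to zero, so the form is the sum of the real forms of the real and
    imaginary parts of the coefficients: if it is not nonnegative, neither is
    the real form. *)
Lemma not_Phi_kappa_minus (R : realType) n (g : R -> R) :
  continuous_nneg g -> ~ Phi n g ->
  exists (N : nat) (x : 'I_N -> 'rV[R]_n),
    injective x /\ (0 < kappa_minus g x)%N.
Proof.
move=> cg nPhi; apply: contrapT => nex; apply: nPhi; split => // N x xi injx.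
have Q_ge0 (v : 'rV[R]_N) :
    0 <= \sum_k \sum_j v 0 k * v 0 j * g (enorm (x k - x j)).
  rewrite leNgt; apply/negP => Q0; apply: nex; exists N, x; split=> //.
  apply: (neg_def_le_nb_neg_eigenvalues (d := 1) (C := v)).
    exact: schoenberg_mx_sym.
  move=> a a0; have [s aE] : exists s, a = s%:M by exists (a 0 0); exact: mx11_scalar.
  have s0 : s != 0 by apply: contraNneq a0 => s0; rewrite aE s0 raddf0.
  rewrite aE mul_scalar_mx linearZ /= -scalemxAr -!scalemxAl scalerA mxE.
  rewrite -expr2 pmulr_rlt0 ?exprn_even_gt0 // mx_formE.
  apply: le_lt_trans Q0; rewrite le_eqVlt; apply/orP; left; apply/eqP.
  by apply: eq_bigr => k _; apply: eq_bigr => j _; rewrite mxE.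
pose re := \row_k complex.Re (xi k); pose im := \row_k complex.Im (xi k).
have gC k j : g (enorm (x k - x j)) = g (enorm (x j - x k)).
  by rewrite -enormN opprB.
have -> : \sum_k \sum_j real_complex R (g (enorm (x k - x j))) * xi j * conjc (xi k)
  = real_complex R (\sum_k \sum_j re 0 k * re 0 j * g (enorm (x k - x j)) +
     \sum_k \sum_j im 0 k * im 0 j * g (enorm (x k - x j))).
  pose T k j := 'i%C * real_complex R
    (g (enorm (x k - x j)) * im 0 j * re 0 k) : R[i].
  have TC : \sum_k \sum_j T k j - \sum_k \sum_j T j k = 0.
    by rewrite exchange_big subrr.
  rewrite -[RHS]addr0 -[X in _ + X]TC.
  rewrite -big_split /= rmorph_sum -sumrB -big_split /=; apply: eq_bigr => k _.
  rewrite -big_split /= rmorph_sum -sumrB -big_split /=; apply: eq_bigr => j _.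
  rewrite /T gC !mxE; case: (xi k) (xi j) => [a b] [c d].
  by apply/eqP; rewrite eq_complex /=; apply/andP; split; apply/eqP; ring.
by rewrite ler0c addr_ge0.
Qed.

Theorem theorem1p4 (R : realType) :
  (forall (m : nat) (g : R -> R) (ginfty : R),
     (1 <= m)%N ->
     continuous_nneg g ->
     g t @[t --> +oo] --> ginfty ->
     0 <= ginfty ->
     (exists (N : nat) (y : 'I_N -> 'rV[R]_m),
        injective y /\ (1 <= kappa_minus g y)%N) ->
     kappa_minus_sup m g = +oo%E)
  /\
  (forall (n : nat) (g : R -> R),
     (2 <= n)%N ->
     Phi n g -> ~ Phi n.+1 g ->
     kappa_minus_sup n.+1 g = +oo%E).
Proof.
have infinite (m : nat) (g : R -> R) (ginfty : R) :
    (1 <= m)%N -> g t @[t --> +oo] --> ginfty -> 0 <= ginfty ->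
    (exists (N : nat) (y : 'I_N -> 'rV[R]_m),
      injective y /\ (1 <= kappa_minus g y)%N) ->
    kappa_minus_sup m g = +oo%E.
  case: m => // m _ cvg_g ginfty0 [N [y [injy ky]]].
  apply/eqyP => A A0.
  have [d Ad] : exists d : nat, A < d%:R by eexists; exact: truncnS_gt.
  have [N' [x [injx dk]]] := kappa_minus_unbounded d cvg_g ginfty0 injy ky.
  apply: (@le_trans _ _ ((kappa_minus g x)%:R)%:E).
    by rewrite lee_fin (le_trans (ltW Ad)) // ler_nat.
  by apply: ereal_sup_ubound; exists N', x.
split=> [m g ginfty m1 _|n g n2 Pg nPg]; first exact: infinite.
have [c c0 cvg_g] : exists2 c : R, 0 <= c & g t @[t --> +oo] --> c.
  by case: n n2 Pg {nPg} => [|[|n]] // _; exact: Phi_cvg_pinfty.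
apply: infinite cvg_g c0 _ => //; apply: not_Phi_kappa_minus nPg.
by case: Pg.
Qed.
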